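(* Let $k>1$ be a natural number, let $n\ge 1$ be a multiple of $k$, and let $\omega\in\mathbb{C}$, $\omega\neq 1$, be a $k$-th root of unity. Let $C_n^k$ be the $k$-uniform cycle on $\mathbb{Z}_n$, and let $x_\omega:\mathbb{Z}_n\to\mathbb{C}$ be the vector $x_\omega(i)=\omega^i$ for all $i\in\mathbb{Z}_n$. Then $B_{C_n^k}x_\omega=0$.
   Context: A hypergraph $H$ is a pair $(V(H),E(H))$ with $V(H)$ a non-empty set (vertices) and $E(H)$ a set of non-empty subsets of $V(H)$ (hyperedges). The edge-vertex incidence matrix $B_H=[b_{ev}]_{e\in E(H),v\in V(H)}$ has $b_{ev}=1$ if $v\in e$ and $b_{ev}=0$ otherwise; for a vector $x:V(H)\to\mathbb{C}$, $(B_Hx)(e)=\sum_{v\in e}x(v)$. For $k\ge 2$ and $n\ge k$, the $k$-uniform cycle $C_n^k$ is the hypergraph with vertex set $\mathbb{Z}_n$ (integers modulo $n$) and hyperedge set $\{e_i: i\in\mathbb{Z}_n\}$, where $e_i=\{i,i+1,\ldots,i+(k-1)\}$ with addition in $\mathbb{Z}_n$. Since $k$ divides $n$, $\omega^n=1$, so $\omega^i$ is well defined for $i\in\mathbb{Z}_n$. *)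

(* Defs.v *)
From HB Require Import structures.
From mathcomp Require Import all_boot all_order all_algebra.
From mathcomp Require Export reals complex.
Set Implicit Arguments.
Unset Strict Implicit.
Unset Printing Implicit Defensive.
Import GRing.Theory.
Local Open Scope ring_scope.

Record hypergraph := Hypergraph {
  vertex : finType;
  hyperedges : {set {set vertex}};
  vertex_neq0 : (0 < #|vertex|)%N;
  hyperedge_neq0 : set0 \notin hyperedges
}.

(* Rows and columns are numbered by the canonical enumerations ([enum_val]) of
   the hyperedges and of the vertices. *)
Definition incidence_mx (F : nzRingType) (H : hypergraph) :
    'M[F]_(#|hyperedges H|, #|vertex H|) :=
  \matrix_(e < #|hyperedges H|, v < #|vertex H|) (enum_val v \in enum_val e)%:R.

Definition vertex_col (F : nzRingType) (H : hypergraph) (x : vertex H -> F) :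
    'cV[F]_#|vertex H| :=
  \col_(v < #|vertex H|) x (enum_val v).

Lemma incidence_mx_mulE (F : nzRingType) (H : hypergraph) (x : vertex H -> F)
    (e : 'I_#|hyperedges H|) :
  (incidence_mx F H *m vertex_col x) e 0 = \sum_(v in enum_val e) x v.
Proof.
rewrite mxE [RHS]big_mkcond /= [RHS](reindex_onto enum_val enum_rank) /=; last first.
  by move=> v _; rewrite enum_rankK.
rewrite [RHS](eq_bigl xpredT); last by move=> v; rewrite enum_valK eqxx.
by apply: eq_bigr => v _; rewrite !mxE; case: ifP; rewrite ?mul1r ?mul0r.
Qed.

Definition cycle_edge (n k : nat) (i : 'Z_n) : {set 'Z_n} :=
  [set i + j%:R | j : 'I_k].

Lemma cycle_edges_neq0 (n k : nat) (k_gt1 : (1 < k)%N) :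
  set0 \notin [set cycle_edge k i | i : 'Z_n].
Proof.
apply/imsetP => -[i _ /setP /(_ (i + 0%:R))]; rewrite inE => /esym/negP; apply.
exact: (imset_f _ (x := Ordinal (ltnW k_gt1))).
Qed.

Lemma Zn_neq0 (n : nat) : (0 < #|{: 'Z_n}|)%N.
Proof. by rewrite card_ord. Qed.

(* The hypotheses give [1 < n], so that ['Z_n] really is Z/nZ. *)
Definition uniform_cycle (n k : nat) (k_gt1 : (1 < k)%N) (k_le_n : (k <= n)%N) :
    hypergraph :=
  Hypergraph (Zn_neq0 n) (cycle_edges_neq0 n k_gt1).

Lemma uniform_cycleP (n k : nat) (k_gt1 : (1 < k)%N) (k_le_n : (k <= n)%N) :
  forall e, e \in hyperedges (uniform_cycle k_gt1 k_le_n) -> #|e| = k.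
Proof.
move=> _ /imsetP[i _ ->]; rewrite card_imset ?card_ord // => j1 j2 /addrI.
have n_gt1 := leq_trans k_gt1 k_le_n.
move/(congr1 val); rewrite /= !val_Zp_nat // !modn_small ?(leq_trans (ltn_ord _)) //.
exact: val_inj.
Qed.

(* [i : 'Z_n] is coerced to its representative in [0, n-1]; [root_vecE] shows
   that any other representative gives the same value when [k %| n]. *)
Definition root_vec (F : nzRingType) (n : nat) (omega : F) : 'Z_n -> F :=
  fun i => omega ^+ i.

Lemma root_vecE (F : nzRingType) (n k : nat) (omega : F) (m : nat) :
  (1 < n)%N -> (k %| n)%N -> k.-unity_root omega ->
  root_vec omega (m%:R : 'Z_n) = omega ^+ m.
Proof.
move=> n_gt1 /dvdnP[q def_n] /unity_rootP omega_k.
rewrite /root_vec val_Zp_nat // [in RHS](divn_eq m n) exprD.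
by rewrite [in X in _ = X * _]def_n mulnA [X in _ ^+ X * _]mulnC exprM omega_k expr1n mul1r.
Qed.

(* Main.v *)
Require Import Defs.
From HB Require Import structures.
From mathcomp Require Import all_boot all_order all_algebra.
From mathcomp Require Import reals complex.
Import GRing.Theory.
Local Open Scope ring_scope.

(** Each entry of the product is the sum of the powers of [omega] along one
    edge, that is along [k] consecutive residues [i, ..., i + (k - 1)].  Since
    [omega ^+ k = 1] and [k %| n], exponents may be read modulo [n], so this sum
    is [omega ^+ i] times the full geometric sum
    [1 + omega + ... + omega ^+ k.-1].  The latter vanishes, because its product
    with [omega - 1], which is nonzero, is [omega ^+ k - 1 = 0]. *)

Lemma geometric_sum_unity_root (F : idomainType) (k : nat) (omega : F) :
  omega != 1 -> k.-unity_root omega -> \sum_(j < k) omega ^+ j = 0.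
Proof.
move=> omega_neq1 /unity_rootP omega_k; have := subrX1 omega k.
rewrite omega_k subrr => /esym/eqP.
by rewrite mulf_eq0 subr_eq0 (negPf omega_neq1) => /eqP.
Qed.

(** The bound [k <= n] keeps the [k] translates distinct: an edge that wrapped
    around the cycle would be a set with fewer elements than the sum has
    terms. *)
Lemma sum_cycle_edge (V : nmodType) (n k : nat) (i : 'Z_n) (x : 'Z_n -> V) :
  (1 < n)%N -> (k <= n)%N ->
  \sum_(v in cycle_edge k i) x v = \sum_(j < k) x (i + j%:R).
Proof.
move=> n_gt1 k_le_n; rewrite big_imset //= => j1 j2 _ _ /addrI/(congr1 val).
rewrite /= !val_Zp_nat // !modn_small ?(leq_trans (ltn_ord _)) //.
exact: val_inj.
Qed.

Lemma sum_root_vec_cycle_edge (F : idomainType) (n k : nat) (omega : F)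
    (i : 'Z_n) :
  (1 < n)%N -> (k <= n)%N -> (k %| n)%N ->
  omega != 1 -> k.-unity_root omega ->
  \sum_(v in cycle_edge k i) root_vec omega v = 0.
Proof.
move=> n_gt1 k_le_n k_dvd_n omega_neq1 omega_root.
rewrite sum_cycle_edge // (eq_bigr (fun j : 'I_k => omega ^+ i * omega ^+ j)).
  by rewrite -mulr_sumr geometric_sum_unity_root ?mulr0.
by move=> j _; rewrite -[i in LHS]natr_Zp -natrD (root_vecE _ n_gt1 k_dvd_n omega_root) exprD.
Qed.

Theorem proposition2p4 (R : realType) (n k : nat)
    (k_gt1 : (1 < k)%N) (n_ge1 : (1 <= n)%N) (k_dvd_n : (k %| n)%N)
    (omega : R[i]%C) (omega_neq1 : omega != 1)
    (omega_root : k.-unity_root omega) :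
  let C := uniform_cycle k_gt1 (dvdn_leq n_ge1 k_dvd_n) in
  incidence_mx R[i]%C C *m vertex_col (H := C) (root_vec omega) = 0.
Proof.
move=> C; have k_le_n := dvdn_leq n_ge1 k_dvd_n.
apply/matrixP => e j; rewrite (ord1 j) incidence_mx_mulE [RHS]mxE.
have /imsetP[i _ ->] := enum_valP e.
exact: sum_root_vec_cycle_edge (leq_trans k_gt1 k_le_n) _ _ _ _.
Qed.
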